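(* Let $\mathcal{H}$ be a complex Hilbert space and let $T\in\mathcal{B}(\mathcal{H})$ be non-contractive (i.e. not a contraction) and similar to a contraction. Then there is an invertible positive operator $A_0\in\mathcal{B}(\mathcal{H})$ with $T^*A_0T\le A_0$ and $A_0\ge T^*T$, and $T$ has a $2$-isometric lifting of type II and of covariance $\sqrt2\cdot\|A_0\|^{1/2}$, with $\|A_0\|\ge\|T\|$.
   Context: All Hilbert spaces are complex and operators are bounded and linear. $S$ is a $2$-isometry if $S^{*2}S^2-2S^*S+I=0$; its covariance is $\|S^*S-I\|^{1/2}$. If $\mathcal{H}$ is a closed subspace of $\mathcal{K}$, $S\in\mathcal{B}(\mathcal{K})$ is a lifting of $T\in\mathcal{B}(\mathcal{H})$ if $P_{\mathcal{H}}S=TP_{\mathcal{H}}$. A $2$-isometric lifting $S$ of $T$ is of type II if $S^*S\mathcal{H}\subset\mathcal{H}$. *)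

(* Defs.v *)
From HB Require Import structures.
From mathcomp Require Import all_boot all_order all_algebra sesquilinear.
From mathcomp Require Import complex.
From mathcomp Require Import boolp classical_sets functions reals.
From mathcomp Require Import topology normedtype.

Set Implicit Arguments.
Unset Strict Implicit.
Unset Printing Implicit Defensive.

Import Order.TTheory GRing.Theory Num.Theory.
Import numFieldNormedType.Exports.

Local Open Scope complex_scope.
Local Open Scope classical_set_scope.
Local Open Scope ring_scope.

(* The inner product is linear in its first argument and conjugate-linear in
   the second.  Completeness refers to the uniformity of the norm, which
   [sqr_normE] ties to the inner product. *)
HB.mixin Record CompleteNormedModule_isHilbert (R : realType) H
    of CompleteNormedModule R[i] H := {
  inner : {dot H for (@Num.conj R[i])} ;
  sqr_normE : forall x : H, `|x| ^+ 2 = inner x x }.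

#[short(type="hilbertType")]
HB.structure Definition Hilbert (R : realType) :=
  {H of CompleteNormedModule R[i] H & CompleteNormedModule_isHilbert R H}.

Section Operators.
Variable R : realType.
Implicit Types H K : hilbertType R.

(* Norms of vectors are elements of [R[i]]; [rnorm] is the same number in
   [R]. *)
Definition rnorm H (x : H) : R := complex.Re `|x|.

Definition bounded_operator H K (T : {linear H -> K}) : Prop :=
  exists M : R, forall x, rnorm (T x) <= M * rnorm x.

(* Only meaningful for bounded operators ([sup] is 0 on unbounded sets). *)
Definition opnorm H K (T : H -> K) : R :=
  sup [set rnorm (T x) | x in [set x | rnorm x <= 1]].

(* Hilbert-space adjoint: [adj T y] is the vector [z] such that
   <T x, y> = <x, z> for all [x]; for a bounded operator [T] it exists, by the
   Riesz representation theorem, and is unique. *)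
Definition adj H K (T : H -> K) : K -> H :=
  fun y => get [set z : H | forall x : H, inner (T x) y = inner x z].

(* As [0 <= z] in [R[i]] says that [z] is real and nonnegative, this includes
   self-adjointness. *)
Definition positive_operator H (A : H -> H) : Prop :=
  forall x : H, 0 <= inner (A x) x.

Definition le_operator H (A B : H -> H) : Prop := positive_operator (B - A).

Definition inverse_operators H (A B : {linear H -> H}) : Prop :=
  [/\ bounded_operator A, bounded_operator B, A \o B = id & B \o A = id].

Definition invertible_operator H (A : {linear H -> H}) : Prop :=
  exists B : {linear H -> H}, inverse_operators A B.

Definition contraction_operator H (T : H -> H) : Prop := opnorm T <= 1.

Definition similar_to_contraction H (T : {linear H -> H}) : Prop :=
  exists L M C : {linear H -> H},
    [/\ inverse_operators L M, bounded_operator C,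
        contraction_operator C & T = M \o C \o L :> (H -> H)].

Definition two_isometry K (S : K -> K) : Prop :=
  adj S \o adj S \o S \o S - 2%:R *: (adj S \o S) + id = 0 :> (K -> K).

Definition covariance K (S : K -> K) : R :=
  Num.sqrt (opnorm (adj S \o S - id)).

(* [H] is regarded as a closed subspace of [K] through an isometric linear
   embedding [J]; the range of [J] is closed because [H] is complete. *)
Definition isometric_embedding H K (J : {linear H -> K}) : Prop :=
  forall x y : H, inner (J x) (J y) = inner x y.

(* Orthogonal projection of [K] onto the range of the isometric embedding [J],
   read back in [H]. *)
Definition proj H K (J : H -> K) : K -> H :=
  fun k => get [set h : H | forall g : H, inner (k - J h) (J g) = 0].

Definition lifting H K (J : {linear H -> K})
    (T : {linear H -> H}) (S : {linear K -> K}) : Prop :=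
  [/\ isometric_embedding J, bounded_operator S &
      proj J \o S = T \o proj J].

Definition two_isometric_lifting_typeII H K (J : {linear H -> K})
    (T : {linear H -> H}) (S : {linear K -> K}) : Prop :=
  [/\ lifting J T S, two_isometry S &
      (adj S \o S) @` range J `<=` range J].

End Operators.

(* Main.v *)
Require Import Defs.
From HB Require Import structures.
From mathcomp Require Import all_boot all_order all_algebra sesquilinear.
From mathcomp Require Import complex.
From mathcomp Require Import boolp classical_sets functions reals.
From mathcomp Require Import topology normedtype sequences.
From mathcomp Require Import ring lra.

Set Implicit Arguments.
Unset Strict Implicit.
Unset Printing Implicit Defensive.

Import Order.TTheory GRing.Theory Num.Theory.
Import numFieldNormedType.Exports.

Local Open Scope complex_scope.
Local Open Scope classical_set_scope.
Local Open Scope ring_scope.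

(** Write T = M C L with M the inverse of L and C a contraction. For the norm
    |L x| the operator T is a contraction, that is T^* B T <= B for
    B = L^* L; since L is invertible, a large multiple A0 = c B also dominates
    T^* T ([dominating_operator_exists]).

    A lifting S whose defect S^* S - I restricts to 2 A0 on H is then found on
    a space K of sequences u_0, u_1, ... in H, on which S is the shift
    (u_0, u_1, ...) |-> (T u_0, u_0, u_1, ...); the coordinate 0 carries H.
    The only freedom is the inner product of K, taken to be a sum of forms
    w_n (u_n, v_n) with w_0 the inner product of H. The requirement on H gives
    w_1 = 2 A0 + I - T^* T, and for a shift the 2-isometry identity says that
    the weights grow arithmetically from w_1 on, w_(k+1) = w_1 + k E; at the
    coordinate 0 it forces E = 2 (A0 - T^* A0 T). The two domination
    properties of A0 are what make E nonnegative and every w_n at least the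
    inner product of H, so that K is a Hilbert space.

    With these weights the form of S^* S - I is 2 A0 on the coordinate 0 plus
    E on every other one ([psum_shift]). Replacing u by S u leaves it unchanged
    because 2 T^* A0 T + E = 2 A0 ([defect_shift]): this is the 2-isometry
    identity. It has no mixed terms between H and the other coordinates: this
    is type II. Its norm is at least 2 |A0| because of H, and at most 2 |A0|
    because E <= 2 A0 and a nonnegative form bounded by M |u|^2 is that of an
    operator of norm at most M, by Cauchy-Schwarz ([lifting_exists]).

    Finally |T|^2 <= |A0| since T^* T <= A0, and |T| > 1 gives |T| <= |A0|.
    Adjoints exist by the Riesz representation theorem ([riesz]). *)

(** * Real and imaginary parts *)

Section ComplexParts.
Variable R : realType.
Implicit Types (z w : R[i]) (t : R).

Lemma cReD z w : complex.Re (z + w) = complex.Re z + complex.Re w.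
Proof. by case: z w => [a b] [c d]. Qed.

Lemma cReB z w : complex.Re (z - w) = complex.Re z - complex.Re w.
Proof. by case: z w => [a b] [c d]. Qed.

Lemma cImD z w : complex.Im (z + w) = complex.Im z + complex.Im w.
Proof. by case: z w => [a b] [c d]. Qed.

Lemma cReM z w : complex.Re (z * w) =
  complex.Re z * complex.Re w - complex.Im z * complex.Im w.
Proof. by case: z w => [a b] [c d]. Qed.

Lemma cImM z w : complex.Im (z * w) =
  complex.Re z * complex.Im w + complex.Im z * complex.Re w.
Proof. by case: z w => [a b] [c d]. Qed.

Lemma cReZ t z : complex.Re (t%:C * z) = t * complex.Re z.
Proof. by rewrite cReM /= mul0r subr0. Qed.

Lemma cRe_conj z : complex.Re (Num.conj z) = complex.Re z.
Proof. by case: z. Qed.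

Lemma cIm_conj z : complex.Im (Num.conj z) = - complex.Im z.
Proof. by case: z. Qed.

Lemma conj_real t : Num.conj t%:C = t%:C :> R[i].
Proof. by apply/eqP; rewrite eq_complex /= oppr0 !eqxx. Qed.

Lemma ge0_ReE z : 0 <= z -> z = (complex.Re z)%:C.
Proof. by case: z => a b; rewrite lecE /= => /andP[/eqP-> _]. Qed.

Lemma Re_ge0 z : 0 <= z -> 0 <= complex.Re z.
Proof. by case: z => a b; rewrite lecE /= => /andP[]. Qed.

Lemma eq_ReIm z w : complex.Re z = complex.Re w ->
  complex.Im z = complex.Im w -> z = w.
Proof. by case: z w => [a b] [c d] /= -> ->. Qed.

End ComplexParts.

(** * Nonnegative Hermitian forms *)

Lemma discriminant_le0 (R : realType) (a b c : R) :
  (forall t, 0 <= a + 2 * (t * b) + t ^+ 2 * c) -> b ^+ 2 <= a * c.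
Proof.
move=> H; pose P := Poly [:: a; 2 * b; c].
have P_ge0 t : 0 <= P.[t].
  by rewrite horner_Poly /=; have := H t; congr (_ <= _); ring.
have := deg_le2_poly_ge0 (size_Poly [:: a; 2 * b; c]) P_ge0.
rewrite !coef_Poly /=; lra.
Qed.

(** A plain predicate on functions, rather than a bundled structure, because the
    same data [x, y |-> inner (A x) y] must be recognized as a form for many
    operators. Nonnegativity is asked of the real part only: the value on the
    diagonal is real by Hermitian symmetry. *)
Record pos_form (R : realType) (U : lmodType R[i]) (p : U -> U -> R[i]) : Prop :=
  PosForm {
  pform_lin : forall a x y z, p (a *: x + y) z = a * p x z + p y z;
  pform_conj : forall x y, p y x = Num.conj (p x y);
  pform_ge0 : forall x, 0 <= complex.Re (p x x) }.

Section PosForm.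
Variables (R : realType) (U : lmodType R[i]) (p : U -> U -> R[i]).
Hypothesis pP : pos_form p.
Local Notation q x := (complex.Re (p x x)).

Lemma pformDl x y z : p (x + y) z = p x z + p y z.
Proof. by have := pform_lin pP 1 x y z; rewrite scale1r mul1r. Qed.

Lemma pform0l z : p 0 z = 0.
Proof. by apply: (addrI (p 0 z)); rewrite -pformDl !addr0. Qed.

Lemma pformZl a x z : p (a *: x) z = a * p x z.
Proof. by rewrite -[a *: x]addr0 (pform_lin pP) pform0l addr0. Qed.

Lemma pformNl x z : p (- x) z = - p x z.
Proof. by rewrite -scaleN1r pformZl mulN1r. Qed.

Lemma pformBl x y z : p (x - y) z = p x z - p y z.
Proof. by rewrite pformDl pformNl. Qed.

Lemma pformDr x y z : p x (y + z) = p x y + p x z.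
Proof. by rewrite (pform_conj pP) pformDl rmorphD /= -!(pform_conj pP). Qed.

Lemma pformZr a x y : p x (a *: y) = Num.conj a * p x y.
Proof. by rewrite (pform_conj pP) pformZl rmorphM /= -!(pform_conj pP). Qed.

Lemma pform0r x : p x 0 = 0.
Proof. by rewrite (pform_conj pP) pform0l rmorph0. Qed.

Lemma pformNr x z : p x (- z) = - p x z.
Proof. by rewrite (pform_conj pP) pformNl rmorphN /= -(pform_conj pP). Qed.

Lemma pformBr x y z : p x (y - z) = p x y - p x z.
Proof. by rewrite pformDr pformNr. Qed.

Lemma pform_real x : p x x = (q x)%:C.
Proof.
apply: eq_ReIm => //=.
have /(congr1 (@complex.Im R)) := pform_conj pP x x; rewrite cIm_conj.
lra.
Qed.

Lemma pform_sym x y : complex.Re (p y x) = complex.Re (p x y).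
Proof. by rewrite (pform_conj pP) cRe_conj. Qed.

Lemma qpformD x y : q (x + y) = q x + 2 * complex.Re (p x y) + q y.
Proof.
by rewrite pformDl !pformDr !cReD [complex.Re (p y x)]pform_sym; ring.
Qed.

Lemma qpformB x y : q (x - y) = q x - 2 * complex.Re (p x y) + q y.
Proof.
by rewrite pformBl !pformBr !cReB [complex.Re (p y x)]pform_sym; ring.
Qed.

Lemma qpformZ a x : q (a *: x) = complex.Re (a * Num.conj a) * q x.
Proof.
rewrite pformZl pformZr mulrA (pform_real x) [_ * (q x)%:C]mulrC cReZ.
by rewrite mulrC.
Qed.

Lemma qpform_scale t x : q (t%:C *: x) = t ^+ 2 * q x.
Proof. by rewrite qpformZ conj_real cReZ /= expr2. Qed.

Lemma pform_polar x y : complex.Re (p x y) = (q (x + y) - q (x - y)) / 4.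
Proof. by rewrite qpformD qpformB; field. Qed.

Lemma pform_CauchySchwarz x y : complex.Re (p x y) ^+ 2 <= q x * q y.
Proof.
set b := complex.Re (p x y).
have H t : 0 <= q x + 2 * (t * b) + t ^+ 2 * q y.
  have := pform_ge0 pP (x + t%:C *: y).
  by rewrite qpformD qpform_scale pformZr conj_real cReZ.
exact: discriminant_le0.
Qed.

Lemma pform_le_sqrt x y : complex.Re (p x y) <= Num.sqrt (q x) * Num.sqrt (q y).
Proof.
apply: (le_trans (ler_norm _)).
rewrite -sqrtrM ?(pform_ge0 pP)// -sqrtr_sqr ler_wsqrtr//.
exact: pform_CauchySchwarz.
Qed.

Lemma qpformD_le x y : q (x + y) <= 2 * q x + 2 * q y.
Proof. have := pform_ge0 pP (x - y); rewrite qpformB qpformD; lra. Qed.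

End PosForm.

(** * Norm, adjoint and Riesz representation *)

Section HilbertNorm.
Variable R : realType.
Implicit Types H K : hilbertType R.

Lemma inner_form H : pos_form (@inner R H).
Proof.
split=> [a x y z|x y|x].
- by rewrite linearDl/= linearZl_LR.
- by rewrite hermC /= expr0 mul1r.
- by apply: Re_ge0; apply: dnorm_ge0.
Qed.

Lemma rnormE H (x : H) : `|x| = (rnorm x)%:C.
Proof. exact/ge0_ReE/normr_ge0. Qed.

Lemma rnorm_ge0 H (x : H) : 0 <= rnorm x.
Proof. exact/Re_ge0/normr_ge0. Qed.

Lemma rnorm_sqr H (x : H) : rnorm x ^+ 2 = complex.Re (inner x x).
Proof. by rewrite -sqr_normE rnormE -rmorphXn. Qed.

Lemma rnorm_sqrt H (x : H) : rnorm x = Num.sqrt (complex.Re (inner x x)).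
Proof. by rewrite -rnorm_sqr sqrtr_sqr ger0_norm// rnorm_ge0. Qed.

Lemma rnorm_eq0 H (x : H) : rnorm x = 0 -> x = 0.
Proof. by move=> x0; apply/normr0_eq0; rewrite rnormE x0. Qed.

Lemma rnorm0 H : rnorm (0 : H) = 0.
Proof. by rewrite /rnorm normr0. Qed.

Lemma rnormZ H t (x : H) : 0 <= t -> rnorm (t%:C *: x) = t * rnorm x.
Proof. by move=> t0; rewrite /rnorm normrZ ger0_norm ?ler0c// cReZ. Qed.

Lemma rnormB H (x y : H) : rnorm (x - y) = rnorm (y - x).
Proof. by rewrite /rnorm distrC. Qed.

Lemma Re_inner_le H (x y : H) : complex.Re (inner x y) <= rnorm x * rnorm y.
Proof. by rewrite !rnorm_sqrt; apply/pform_le_sqrt/inner_form. Qed.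

Lemma inner_inj H (y z : H) : (forall x, inner x y = inner x z) -> y = z.
Proof.
move=> yz; apply/eqP; rewrite -subr_eq0; apply/eqP/rnorm_eq0/eqP.
by rewrite -sqrf_eq0 rnorm_sqr (pformBr (inner_form H)) yz subrr.
Qed.

(** Vectors are separated by their inner products, so the element chosen in the
    definition of the adjoint is any one with the defining property. *)
Lemma adjE H K (T : H -> K) y z :
  (forall x, inner (T x) y = inner x z) -> adj T y = z.
Proof.
move=> Tyz; apply: inner_inj => x; rewrite -Tyz.
by rewrite -(@getPex _ [set z | forall x, inner (T x) y = inner x z] _ x);
   last by exists z.
Qed.

(** Two candidates for the projection of [k] have images whose difference is
    orthogonal to the range of [J], hence to itself. *)
Lemma projE H K (J : {linear H -> K}) k h : isometric_embedding J ->
  (forall g, inner (k - J h) (J g) = 0) -> proj J k = h.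
Proof.
move=> Jiso kh.
have := @getPex _ [set h | forall g : H, inner (k - J h) (J g) = 0]
  (ex_intro _ h kh).
rewrite -/(proj J k) /= => kp; apply/eqP; rewrite -subr_eq0; apply/eqP.
apply: rnorm_eq0; apply/eqP; rewrite -sqrf_eq0 rnorm_sqr -Jiso {1}linearB /=.
have -> : J (proj J k) - J h = (k - J h) - (k - J (proj J k)).
  by rewrite opprB [RHS]addrC addrA subrK.
by rewrite (pformBl (inner_form K)) kh kp subr0.
Qed.

Lemma complete_seq H (u : nat -> H) :
  (forall e : R, 0 < e -> exists N, forall m n, (N <= m)%N -> (N <= n)%N ->
     rnorm (u m - u n) <= e) ->
  exists l, forall e : R, 0 < e -> exists N, forall n, (N <= n)%N ->
     rnorm (l - u n) <= e.
Proof.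
move=> uC.
have : cvg (u @ \oo).
  apply: cauchy_cvg; apply/cauchy_ballP => e e0.
  have e0' : 0 < complex.Re e / 2.
    by move: e0; rewrite ltcE /= => /andP[_ ?]; rewrite divr_gt0.
  have [N NP] := uC _ e0'.
  pose A := u @` [set n | (N <= n)%N].
  have nA : nbhs (u @ \oo) A by exists N => // n Nn; exists n.
  exists (A, A) => // -[_ _] /= [[m Nm <-] [n Nn <-]].
  rewrite -ball_normE /= rnormE.
  have : rnorm (u m - u n) < complex.Re e.
    by apply: (le_lt_trans (NP m n Nm Nn)); lra.
  by rewrite -ltcR -(ge0_ReE (ltW e0)).
move=> /cvg_ex[l ul]; exists l => e e0.
have e0' : 0 < e%:C :> R[i] by rewrite ltcR.
have /cvgrPdist_le/(_ _ e0')[N _ NP] := ul.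
by exists N => n Nn; have := NP n Nn; rewrite /= rnormE lecR.
Qed.

Lemma le0_small (a b : R) : (forall e, 0 < e -> a <= e * b) -> a <= 0.
Proof.
move=> ab; case: (leP b 0) => b0.
  by have := ab 1 ltr01; lra.
rewrite leNgt; apply/negP => a0.
have := ab (a / (2 * b)); rewrite divr_gt0 ?mulr_gt0// => /(_ isT).
have -> : a / (2 * b) * b = a / 2 by field; rewrite gt_eqF.
lra.
Qed.

(** The representing vector minimizes [J x = |x|^2 - 2 Re (f x)]. Minimizing
    sequences are Cauchy by the parallelogram identity; since [J] is within
    [1 / n] of its infimum at [u n], comparing it with [J (u n + t x)] for all
    real [t] bounds [Re <u n, x> - Re f x] by a discriminant, so that no
    continuity of [J] is needed to pass to the limit. *)
Lemma riesz H (f : H -> R[i]) (M : R) :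
  (forall a x y, f (a *: x + y) = a * f x + f y) ->
  (forall x, complex.Re (f x) <= M * rnorm x) ->
  exists z, forall x, f x = inner x z.
Proof.
move=> flin fM; have iP := inner_form H.
have f0 : f 0 = 0.
  have := flin 1 0 0; rewrite scale1r mul1r addr0.
  by move=> /(congr1 (fun z => z - f 0)); rewrite subrr addrK.
pose J x := rnorm x ^+ 2 - 2 * complex.Re (f x).
pose E := range J.
(* Completing the square in rnorm x. *)
have JM x : - M ^+ 2 <= J x.
  rewrite /J; have := fM x; have := sqr_ge0 (rnorm x - M); nra.
have Einf : has_inf E.
  by split; [exists (J 0), 0 | exists (- M ^+ 2) => _ [x _ <-]].
set d := inf E.
have dJ x : d <= J x by apply: ge_inf; [case: Einf|exists x].
have fZ t x : complex.Re (f (t%:C *: x)) = t * complex.Re (f x).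
  by rewrite -[_ *: x]addr0 flin f0 addr0 cReZ.
have fD x y : complex.Re (f (x + y)) = complex.Re (f x) + complex.Re (f y).
  by rewrite -[x]scale1r flin mul1r scale1r cReD.
have /choice[u uP] : forall n, exists x, J x <= d + n.+1%:R^-1.
  move=> n.
  have [|_ [x _ <-] Jx] := @inf_adherent _ E n.+1%:R^-1 _ Einf.
    by rewrite invr_gt0 ltr0n.
  by exists x; rewrite ltW.
have inv_small (e : R) : 0 < e -> exists N, forall n, (N <= n)%N -> n.+1%:R^-1 <= e.
  move=> e0; exists (Num.truncn e^-1) => n Nn.
  rewrite -[e]invrK lef_pV2 ?posrE ?invr_gt0 ?ltr0n//.
  by apply: ltW; apply: lt_le_trans (Num.Theory.truncnS_gt _) _; rewrite ler_nat.
have uC : forall e : R, 0 < e -> exists N, forall m n, (N <= m)%N -> (N <= n)%N ->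
     rnorm (u m - u n) <= e.
  move=> e e0; have [|N NP] := inv_small (e ^+ 2 / 4).
    by rewrite divr_gt0// exprn_gt0.
  exists N => m n Nm Nn.
  rewrite -(@ler_pXn2r _ 2) ?nnegrE ?rnorm_ge0 ?(ltW e0)//.
  have := uP m; have := uP n; have := NP m Nm; have := NP n Nn.
  (* The midpoint cannot go below the infimum, which is the parallelogram
     estimate |u m - u n|^2 <= 2 (J (u m) + J (u n) - 2 d). *)
  have := dJ (2^-1%:C *: (u m + u n)); rewrite /J fZ fD !rnorm_sqr.
  rewrite (qpform_scale iP) (qpformB iP) (qpformD iP).
  set a := complex.Re (inner _ _); set b := complex.Re (inner _ _).
  set c := complex.Re (inner _ _).
  move: (m.+1%:R^-1) (n.+1%:R^-1) => em en; lra.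
have [z zP] := complete_seq uC; exists z.
have main x : complex.Re (inner x z) = complex.Re (f x).
  have first n : (complex.Re (inner (u n) x) - complex.Re (f x)) ^+ 2
      <= n.+1%:R^-1 * rnorm x ^+ 2.
    pose b := complex.Re (inner (u n) x) - complex.Re (f x).
    have H1 t : 0 <= 2 * t * b + t ^+ 2 * rnorm x ^+ 2 + n.+1%:R^-1.
      have := dJ (u n + t%:C *: x); have := uP n.
      rewrite /J fD fZ !rnorm_sqr (qpformD iP) (qpform_scale iP) (pformZr iP).
      rewrite conj_real cReZ /b; move: (n.+1%:R^-1) => en; lra.
    apply: discriminant_le0 => t; have := H1 t; rewrite /b.
    by move: (n.+1%:R^-1) => en; lra.
  have sq : (complex.Re (inner x z) - complex.Re (f x)) ^+ 2 <= 0.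
    apply: (@le0_small _ (4 * rnorm x ^+ 2)) => e e0.
    have [N NP] := inv_small e e0.
    have [N' NP'] : exists N, forall n, (N <= n)%N -> rnorm (z - u n) <= Num.sqrt e.
      by apply: zP; rewrite sqrtr_gt0.
    pose n := maxn N N'.
    have zn : rnorm (z - u n) ^+ 2 <= e.
      rewrite -(sqr_sqrtr (ltW e0)) ler_pXn2r ?nnegrE ?rnorm_ge0 ?sqrtr_ge0//.
      exact/NP'/leq_maxr.
    have := first n; have := NP n (leq_maxl _ _); move: zn.
    have := pform_CauchySchwarz iP x (z - u n); rewrite (pformBr iP) cReB.
    rewrite [complex.Re (inner (u n) x)](pform_sym iP) -!rnorm_sqr.
    set s := complex.Re (inner x z); set t := complex.Re (inner x (u n)).
    set g := complex.Re (f x); set X := rnorm x ^+ 2.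
    have X0 : 0 <= X by apply: sqr_ge0.
    have := sqr_ge0 (s - t - (t - g)).
    move: (n.+1%:R^-1) => en.
    nra.
  by apply/eqP; rewrite -subr_eq0 -sqrf_eq0 eq_le sq sqr_ge0.
move=> x; apply: eq_ReIm; first by rewrite main.
(* The imaginary part at x is, up to sign, the real part at 'i x. *)
have := main ('i%C *: x); rewrite (pformZl iP).
have -> : f ('i%C *: x) = 'i%C * f x.
  by rewrite -[_ *: x]addr0 flin f0 addr0.
by rewrite !cReM /=; lra.
Qed.
End HilbertNorm.

(** * Bounded operators *)

Section BoundedOperators.
Variable R : realType.
Implicit Types H K : hilbertType R.

(** Adjoints and the operators built from them are first obtained as functions;
    this turns them into linear maps. *)
Lemma linear_exists (U V : lmodType R[i]) (f : U -> V) :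
  linear f -> exists g : {linear U -> V}, forall x, g x = f x.
Proof.
move=> flin; pose m := GRing.isLinear.Build _ _ _ _ f flin.
pose g : {linear U -> V} := HB.pack f m.
by exists g.
Qed.

Lemma bounded_ge0 H K (T : {linear H -> K}) : bounded_operator T ->
  exists2 M : R, 0 <= M & forall x, rnorm (T x) <= M * rnorm x.
Proof.
case=> M TM; exists `|M| => // x; apply: (le_trans (TM x)).
by rewrite ler_wpM2r ?rnorm_ge0 ?ler_norm.
Qed.

(** The bound on the adjoint comes from
    [|T' y|^2 = <T T' y, y> <= M |T' y| |y|]. *)
Lemma adjoint_exists H K (T : {linear H -> K}) : bounded_operator T ->
  exists2 T' : {linear K -> H}, bounded_operator T' &
    forall x y, inner (T x) y = inner x (T' y).
Proof.
move=> /bounded_ge0[M M0 TM].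
have [f fE] : {f : K -> H | forall y x, inner (T x) y = inner x (f y)}.
  suff /choice[f fE] : forall y, exists z, forall x, inner (T x) y = inner x z.
    by exists f.
  move=> y; apply: (@riesz _ _ _ (M * rnorm y)) => [a u v|x].
    by rewrite linearP (pform_lin (inner_form K)).
  apply: (le_trans (Re_inner_le _ _)).
  by rewrite mulrAC ler_wpM2r ?rnorm_ge0.
have [T' T'E] : exists g : {linear K -> H}, forall x, g x = f x.
  apply: linear_exists => a u v; apply: inner_inj => x.
  by rewrite -fE !(pformDr (inner_form _)) !(pformZr (inner_form _)) -!fE.
exists T' => [|x y]; last by rewrite T'E fE.
exists M => y; rewrite T'E.
have [->|y0] := eqVneq (rnorm (f y)) 0; first by rewrite mulr_ge0 ?rnorm_ge0.
have fy0 : 0 < rnorm (f y) by rewrite lt_neqAle eq_sym y0 rnorm_ge0.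
rewrite -(ler_pM2l fy0) -expr2 rnorm_sqr -fE.
apply: (le_trans (Re_inner_le _ _)); rewrite mulrCA mulrA.
by rewrite ler_wpM2r ?rnorm_ge0.
Qed.

Lemma opnorm_le_ball H K (T : H -> K) (M : R) :
  (forall x, rnorm x <= 1 -> rnorm (T x) <= M) -> opnorm T <= M.
Proof.
move=> TM; apply: ge_sup.
  by exists (rnorm (T 0)), 0 => //=; rewrite rnorm0.
by move=> _ [x x1 <-]; apply: TM.
Qed.

Lemma opnorm_le H K (T : H -> K) (M : R) : 0 <= M ->
  (forall x, rnorm (T x) <= M * rnorm x) -> opnorm T <= M.
Proof.
move=> M0 TM; apply: opnorm_le_ball => x x1; apply: (le_trans (TM x)).
by rewrite -[leRHS]mulr1 ler_wpM2l.
Qed.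

Lemma opnorm_ge H K (T : H -> K) (M : R) x :
  (forall x, rnorm (T x) <= M * rnorm x) -> rnorm x <= 1 ->
  rnorm (T x) <= opnorm T.
Proof.
move=> TM x1; apply: ub_le_sup; last by exists x.
exists `|M| => _ [y y1 <-]; apply: (le_trans (TM y)).
apply: (@le_trans _ _ (`|M| * rnorm y)).
  by rewrite ler_wpM2r ?rnorm_ge0 ?ler_norm.
by rewrite -[leRHS]mulr1 ler_wpM2l.
Qed.

Lemma opnorm_ge0 H K (T : {linear H -> K}) : bounded_operator T -> 0 <= opnorm T.
Proof.
move=> [M TM]; apply: (le_trans (rnorm_ge0 (T 0))).
by apply: (opnorm_ge TM); rewrite rnorm0.
Qed.

Lemma rnorm_opnorm H K (T : {linear H -> K}) x : bounded_operator T ->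
  rnorm (T x) <= opnorm T * rnorm x.
Proof.
move=> [M TM]; have [x0|x0] := eqVneq (rnorm x) 0.
  by rewrite (rnorm_eq0 x0) linear0 !rnorm0 mulr0.
have xgt0 : 0 < rnorm x by rewrite lt_neqAle eq_sym x0 rnorm_ge0.
have xV0 : 0 <= (rnorm x)^-1 by rewrite invr_ge0 ltW.
have := @opnorm_ge _ _ T M ((rnorm x)^-1%:C *: x) TM.
rewrite linearZ /= !rnormZ// mulVf// lexx => /(_ isT).
by rewrite mulrC ler_pdivrMr.
Qed.

End BoundedOperators.

(** * Limits of complex sequences *)

Section ComplexLimits.
Variable R : realType.
Implicit Types (s t : nat -> R[i]) (l m : R[i]).

(** Convergence is taken componentwise and as a relation with the limit, so
    that only the topology of the real line intervenes and algebraic rules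
    need no separate convergence conditions. *)
Definition ccvg s l :=
  (fun n => complex.Re (s n)) @ \oo --> complex.Re l /\
  (fun n => complex.Im (s n)) @ \oo --> complex.Im l.

Lemma ccvg_unique s l m : ccvg s l -> ccvg s m -> l = m.
Proof.
move=> [sl sl'] [sm sm']; apply: eq_ReIm.
  exact: (cvg_unique (@Rhausdorff R) sl sm).
exact: (cvg_unique (@Rhausdorff R) sl' sm').
Qed.

Lemma ccvg_lin (a : R[i]) s t l m : ccvg s l -> ccvg t m ->
  ccvg (fun n => a * s n + t n) (a * l + m).
Proof.
move=> [sl sl'] [tm tm']; split.
  under eq_fun do rewrite cReD cReM; rewrite cReD cReM.
  by apply: cvgD => //; apply: cvgB; apply: cvgMr.
under eq_fun do rewrite cImD cImM; rewrite cImD cImM.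
by apply: cvgD => //; apply: cvgD; apply: cvgMr.
Qed.

Lemma ccvg_conj s l : ccvg s l -> ccvg (fun n => Num.conj (s n)) (Num.conj l).
Proof.
move=> [sl sl']; split.
  by under eq_fun do rewrite cRe_conj; rewrite cRe_conj.
by under eq_fun do rewrite cIm_conj; rewrite cIm_conj; apply: cvgN.
Qed.

Lemma ccvg_shift s l : ccvg (fun n => s n.+1) l <-> ccvg s l.
Proof.
by rewrite /ccvg (cvg_shiftS (fun n => complex.Re (s n)))
  (cvg_shiftS (fun n => complex.Im (s n))).
Qed.

Lemma ccvg_cst l : ccvg (fun=> l) l.
Proof. by split; apply: cvg_cst. Qed.

End ComplexLimits.

(** * Weighted square-summable sequences *)

Section WeightedL2.
Variables (R : realType) (H : hilbertType R).

(** The lower bound by the norm of [H], uniform in [n], makes the coordinates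
    of a Cauchy filter Cauchy; the upper bound, which may depend on [n], makes
    each finite partial sum continuous. *)
Record weights := Weights {
  weight :> nat -> H -> H -> R[i];
  weight_form : forall n, pos_form (weight n);
  weight_ge : forall n x, rnorm x ^+ 2 <= complex.Re (weight n x x);
  weight_le : forall n, exists C : R, forall x,
    complex.Re (weight n x x) <= C * rnorm x ^+ 2 }.

Variable w : weights.

Definition psum (u v : nat -> H) N : R[i] := \sum_(n < N) w n (u n) (v n).

Lemma psum0 u v : psum u v 0 = 0.
Proof. by rewrite /psum big_ord0. Qed.

Lemma psumS u v N : psum u v N.+1 = psum u v N + w N (u N) (v N).
Proof. by rewrite /psum big_ord_recr. Qed.

Lemma psum_form N : pos_form (fun u v => psum u v N).
Proof.
split=> [a x y z|x y|x].
- rewrite /psum mulr_sumr -big_split/=; apply: eq_bigr => n _.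
  exact: pform_lin (weight_form w n) _ _ _ _.
- rewrite /psum rmorph_sum/=; apply: eq_bigr => n _.
  exact: pform_conj (weight_form w n) _ _.
- rewrite /psum; elim/big_ind: _ => //= [a b ? ?|n _].
    by rewrite cReD addr_ge0.
  exact: pform_ge0 (weight_form w n) _.
Qed.

Definition wsq (u : nat -> H) N : R := complex.Re (psum u u N).

Lemma wsqS u N : wsq u N.+1 = wsq u N + complex.Re (w N (u N) (u N)).
Proof. by rewrite /wsq psumS cReD. Qed.

Lemma wsq_nd u : nondecreasing_seq (wsq u).
Proof.
apply/nondecreasing_seqP => N; rewrite wsqS lerDl.
exact: pform_ge0 (weight_form w N) _.
Qed.

Definition wl2_pred : {pred nat -> H} :=
  fun u => `[< exists M, forall N, wsq u N <= M >].

Lemma wl2P u : reflect (exists M, forall N, wsq u N <= M) (u \in wl2_pred).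
Proof. exact: asboolP. Qed.

Lemma wl2_submod : submod_closed wl2_pred.
Proof.
split.
  apply/wl2P; exists 0 => N; rewrite /wsq.
  by rewrite (pform0l (psum_form N)).
move=> a u v /wl2P[M uM] /wl2P[M' vM'].
apply/wl2P; exists (2 * (complex.Re (a * Num.conj a) * M) + 2 * M') => N.
rewrite /wsq; apply: (le_trans (qpformD_le (psum_form N) _ _)).
rewrite (qpformZ (psum_form N)) lerD// ler_wpM2l//; last exact: vM'.
rewrite ler_wpM2l//; last exact: uM.
by apply: Re_ge0; apply: mul_conjC_ge0.
Qed.

HB.instance Definition _ :=
  GRing.isSubmodClosed.Build _ _ wl2_pred wl2_submod.

Record wl2 := Wl2 { wl2_val :> nat -> H; wl2_valP : wl2_val \in wl2_pred }.

HB.instance Definition _ := [isSub for wl2_val].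
HB.instance Definition _ := [Choice of wl2 by <:].
HB.instance Definition _ := [SubChoice_isSubLmodule of wl2 by <:].

Lemma wl2_eqP (u v : wl2) : (forall n, u n = v n) -> u = v.
Proof. by move=> uv; apply: val_inj; apply: funext. Qed.

Lemma wsq_cvg (u : wl2) : cvgn (wsq u).
Proof.
apply: nondecreasing_is_cvgn; first exact: wsq_nd.
by have /wl2P[M uM] := wl2_valP u; exists M => _ [N _ <-].
Qed.

(** By polarization the real part of a partial sum is a difference of two
    monotone bounded sequences; the imaginary part is treated by multiplying
    one argument by the imaginary unit. *)
Lemma winner_ex : {f : wl2 -> wl2 -> R[i] |
  forall u v : wl2, ccvg (psum u v) (f u v)}.
Proof.
have H1 (u v : wl2) : cvgn (fun N => complex.Re (psum u v N)).
  under eq_fun do rewrite (pform_polar (psum_form _)).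
  apply: is_cvgMl; apply: is_cvgB.
    by rewrite (_ : wl2_val u + wl2_val v = wl2_val (u + v))//; apply: wsq_cvg.
  by rewrite (_ : wl2_val u - wl2_val v = wl2_val (u - v))//; apply: wsq_cvg.
have H2 (u v : wl2) : exists l, ccvg (psum u v) l.
  exists (lim ((fun N => complex.Re (psum u v N)) @ \oo) -i*
          lim ((fun N => complex.Re (psum ('i%C *: u) v N)) @ \oo)).
  split; first exact: H1.
  have -> : (fun n => complex.Im (psum u v n)) =
     - (fun N => complex.Re (psum ('i%C *: u) v N)).
    apply/funext => N; rewrite !fctE (pformZl (psum_form N)) cReM /=; ring.
  by apply: cvgN; apply: H1.
have /choice[f fP] : forall uv : wl2 * wl2, exists l, ccvg (psum uv.1 uv.2) l.
  by move=> uv; apply: H2.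
by exists (fun u v => f (u, v)) => u v; apply: (fP (u, v)).
Qed.

Definition winner := sval winner_ex.

Lemma winnerP (u v : wl2) : ccvg (psum u v) (winner u v).
Proof. exact: (svalP winner_ex). Qed.

Lemma winner_ge N (u : wl2) : wsq u N <= complex.Re (winner u u).
Proof.
have [ul _] := winnerP u u.
rewrite -(cvg_lim (@Rhausdorff _) ul).
apply: (nondecreasing_cvgn_le (@wsq_nd u)).
by apply/cvg_ex; exists (complex.Re (winner u u)).
Qed.

Lemma winner_le (u : wl2) M :
  (forall N, wsq u N <= M) -> complex.Re (winner u u) <= M.
Proof.
move=> uM; have [ul _] := winnerP u u.
rewrite -(cvg_lim (@Rhausdorff _) ul).
apply: limr_le; first by apply/cvg_ex; exists (complex.Re (winner u u)).
by apply: nearW => N; apply: uM.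
Qed.

Lemma winner_form : pos_form winner.
Proof.
split=> [a x y z|x y|x].
- apply: ccvg_unique (winnerP _ _) _.
  have := ccvg_lin a (winnerP x z) (winnerP y z).
  congr (ccvg _ _); apply/funext => N.
  by rewrite -(pform_lin (psum_form N)).
- apply: ccvg_unique (winnerP _ _) _.
  have := ccvg_conj (winnerP x y).
  congr (ccvg _ _); apply/funext => N.
  by rewrite -(pform_conj (psum_form N)).
- by apply: le_trans (winner_ge 0 x); rewrite /wsq psum0.
Qed.

Lemma winner_coord (u : wl2) n : rnorm (u n) ^+ 2 <= complex.Re (winner u u).
Proof.
apply: le_trans (winner_ge n.+1 u); rewrite wsqS.
apply: (le_trans (weight_ge w n _)); rewrite lerDr.
exact: pform_ge0 (psum_form n) _.
Qed.

Lemma winner_eq0 (u : wl2) : complex.Re (winner u u) = 0 -> u = 0.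
Proof.
move=> u0; apply: wl2_eqP => n; apply: rnorm_eq0; apply/eqP.
by rewrite -sqrf_eq0 eq_le sqr_ge0 andbT -u0 winner_coord.
Qed.

Definition wnorm (u : wl2) : R := Num.sqrt (complex.Re (winner u u)).

Lemma wnorm_ge0 u : 0 <= wnorm u. Proof. exact: sqrtr_ge0. Qed.

Lemma wnorm_sqr u : wnorm u ^+ 2 = complex.Re (winner u u).
Proof. by rewrite sqr_sqrtr// (pform_ge0 winner_form). Qed.

Lemma wnormD u v : (wnorm (u + v))%:C <= (wnorm u)%:C + (wnorm v)%:C.
Proof.
rewrite -rmorphD lecR -(@ler_pXn2r _ 2) ?nnegrE ?addr_ge0 ?wnorm_ge0//.
rewrite sqrrD !wnorm_sqr (qpformD winner_form).
have := pform_le_sqrt winner_form u v; rewrite -/(wnorm u) -/(wnorm v); lra.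
Qed.

Lemma wnormZ (a : R[i]) u : (wnorm (a *: u))%:C = `|a| * (wnorm u)%:C.
Proof.
rewrite /wnorm (qpformZ winner_form).
have aa : a * Num.conj a = (complex.Re `|a|)%:C ^+ 2.
  by rewrite -normCK -ge0_ReE// normr_ge0.
rewrite aa -rmorphXn /= sqrtrM ?sqr_ge0// sqrtr_sqr rmorphM/=.
rewrite (ger0_norm (Re_ge0 (normr_ge0 a))).
by rewrite -ge0_ReE// normr_ge0.
Qed.

Lemma wnorm0_eq0 u : (wnorm u)%:C = 0 -> u = 0.
Proof.
move=> /complexI u0; apply: winner_eq0.
by rewrite -wnorm_sqr u0 expr0n.
Qed.

HB.instance Definition _ := Lmodule_isNormed.Build R[i] wl2
  wnormD wnormZ wnorm0_eq0.

Lemma wl2_normE (u : wl2) : `|u| = (wnorm u)%:C. Proof. by []. Qed.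

End WeightedL2.

(** * Completeness of the weighted space *)

Section WeightedL2Complete.
Variables (R : realType) (H : hilbertType R) (w : weights H).

Lemma wl2_rnorm_coord (u : wl2 w) n : rnorm (u n) <= wnorm u.
Proof.
rewrite -(@ler_pXn2r _ 2) ?nnegrE ?rnorm_ge0 ?wnorm_ge0// wnorm_sqr.
exact: winner_coord.
Qed.

(** The coordinates of a Cauchy filter [F] converge to a sequence [l]. If [u]
    stays within [e] of [F]-most [v], then each finite partial sum for [u - l]
    is bounded by [4 e^2], passing to the limit in the finitely many coordinates
    involved; this gives both that [l] is square-summable and that [F]
    converges to it. *)
Lemma wl2_complete (F : set_system (wl2 w)) :
  ProperFilter F -> cauchy F -> cvg F.
Proof.
move=> FF /cauchy_ballP Fc.
have Fcauchy (e : R) : 0 < e -> \forall u & v \near F, wnorm (u - v) <= e.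
  move=> e0; have e0' : 0 < e%:C :> R[i] by rewrite ltcR.
  apply: filterS (Fc _ e0') => -[u v].
  by rewrite -ball_normE /= ltcR => /ltW.
have [l lP] : {l : nat -> H | forall n (e : R), 0 < e ->
    \forall u \near F, rnorm (l n - wl2_val u n) <= e}.
  suff /choice[l lP] : forall n, exists y : H, forall e : R, 0 < e ->
      \forall u \near F, rnorm (y - wl2_val u n) <= e by exists l.
  move=> n.
  have : cvg ((fun u : wl2 w => wl2_val u n) @ F).
    apply: cauchy_cvg; apply/cauchy_ballP => e e0.
    have e0' : 0 < complex.Re e / 2.
      by move: e0; rewrite ltcE /= => /andP[_ ?]; rewrite divr_gt0.
    rewrite near_map2.
    apply: filterS (Fcauchy _ e0') => -[u v] /= uv.
    rewrite -ball_normE /= rnormE.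
    suff : rnorm (wl2_val u n - wl2_val v n) < complex.Re e.
      by rewrite -ltcR -(ge0_ReE (ltW e0)).
    by have := wl2_rnorm_coord (u - v) n; rewrite /=; lra.
  move=> /cvg_ex[y uy]; exists y => e e0.
  have e0' : 0 < e%:C :> R[i] by rewrite ltcR.
  have /cvgrPdist_le/(_ _ e0') := uy.
  by apply: filterS => u; rewrite rnormE lecR.
(* The limit is taken in the first N coordinates only. *)
have near_wsq N (e : R) : 0 < e -> \forall u \near F, wsq w (wl2_val u - l) N <= e.
  elim: N e => [|N IH] e e0.
    by apply: nearW => u; rewrite /wsq /psum big_ord0 ltW.
  have e2 : 0 < e / 2 by rewrite divr_gt0.
  have [C CP] := weight_le w N.
  have d0 : 0 < e / 2 / (`|C| + 1) by rewrite divr_gt0// ltr_pwDr.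
  have d0' : 0 < Num.sqrt (e / 2 / (`|C| + 1)) by rewrite sqrtr_gt0.
  apply: filterS2 (IH _ e2) (lP N _ d0') => u uN luN.
  have lu : rnorm (wl2_val u N - l N) ^+ 2 <= e / 2 / (`|C| + 1).
    rewrite rnormB -(sqr_sqrtr (ltW d0)) ler_pXn2r ?nnegrE ?rnorm_ge0//.
    exact: sqrtr_ge0.
  rewrite wsqS.
  have := CP ((wl2_val u - l) N); rewrite !fctE.
  suff : C * rnorm (wl2_val u N - l N) ^+ 2 <= e / 2 by lra.
  have C1 : 0 < `|C| + 1 by rewrite ltr_pwDr.
  rewrite ler_pdivlMr// in lu.
  apply: le_trans lu; rewrite mulrC ler_wpM2l ?sqr_ge0//.
  by have := ler_norm C; lra.
have bound (e : R) (u : wl2 w) : 0 < e -> (\forall v \near F, wnorm (u - v) <= e) ->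
    forall N, wsq w (wl2_val u - l) N <= 4 * e ^+ 2.
  move=> e0 uF N.
  have e20 : 0 < e ^+ 2 by rewrite exprn_gt0.
  have [v [uv vN]] := filter_ex (filterI uF (near_wsq N _ e20)).
  have uvN := winner_ge N (u - v).
  have {uv} : complex.Re (winner (u - v) (u - v)) <= e ^+ 2.
    by rewrite -wnorm_sqr ler_pXn2r ?nnegrE ?wnorm_ge0// ltW.
  have := qpformD_le (psum_form w N) (wl2_val (u - v)) (wl2_val v - l).
  have -> : wl2_val (u - v) + (wl2_val v - l) = wl2_val u - l.
    by rewrite addrA (_ : wl2_val (u - v) = wl2_val u - wl2_val v)// subrK.
  rewrite -!/(wsq _ _ _); move: uvN vN; lra.
have lpred : l \in wl2_pred w.
  have [u uF] := filter_ex (nearP_dep (Fcauchy 1 ltr01)).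
  rewrite -[l](subKr (wl2_val u)) rpredB ?wl2_valP//.
  by apply/wl2P; exists (4 * 1 ^+ 2); apply: bound.
pose L := Wl2 lpred.
apply/cvg_ex; exists L; apply/cvgrPdist_le => e e0.
have e0' : 0 < complex.Re e / 2.
  by move: e0; rewrite ltcE /= => /andP[_ ?]; rewrite divr_gt0.
apply: filterS (nearP_dep (Fcauchy _ e0')) => u /(bound _ _ e0') uL.
rewrite distrC wl2_normE (ge0_ReE (ltW e0)) lecR.
have e1 : 0 <= complex.Re e by lra.
rewrite -(@ler_pXn2r _ 2) ?nnegrE ?wnorm_ge0// wnorm_sqr.
apply: winner_le => N; apply: (le_trans (uL N)).
by rewrite le_eqVlt; apply/orP; left; apply/eqP; field.
Qed.

HB.instance Definition _ := Uniform_isComplete.Build (wl2 w) wl2_complete.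

Lemma wl2_neq0_gt0 (u : wl2 w) : u != 0 -> 0 < winner u u.
Proof.
move=> u0; rewrite (pform_real (winner_form w)) ltcR lt_neqAle.
rewrite (pform_ge0 (winner_form w)) andbT eq_sym.
by apply: contra u0 => /eqP/winner_eq0 ->.
Qed.

Lemma winner_bilinear :
  bilinear_for (GRing.Scale.Law.clone _ _ *%R _)
    (GRing.Scale.Law.clone _ _ (Num.conj \; *%R) _) (@winner R H w).
Proof.
split=> [v a x y|u a x y] /=.
  exact: pform_lin (winner_form w) _ _ _ _.
by rewrite (pformDr (winner_form w)) (pformZr (winner_form w)).
Qed.

HB.instance Definition _ := bilinear_isBilinear.Build R[i] (wl2 w) (wl2 w)
  R[i] _ _ (@winner R H w) winner_bilinear.

Lemma winner_hermitian (u v : wl2 w) :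
  winner u v = (-1) ^+ false * Num.conj (winner v u).
Proof. by rewrite expr0 mul1r; apply: pform_conj (winner_form w) _ _. Qed.

HB.instance Definition _ := isHermitianSesquilinear.Build R[i] (wl2 w)
  false Num.conj (@winner R H w) winner_hermitian.

HB.instance Definition _ := isDotProduct.Build R[i] (wl2 w)
  (@winner R H w) wl2_neq0_gt0.

Lemma wl2_sqr_normE (u : wl2 w) : `|u| ^+ 2 = winner u u.
Proof. by rewrite wl2_normE -rmorphXn /= wnorm_sqr -(pform_real (winner_form w)). Qed.

HB.instance Definition _ := CompleteNormedModule_isHilbert.Build R (wl2 w)
  wl2_sqr_normE.


End WeightedL2Complete.

(** * The 2-isometric lifting attached to a dominating operator *)

Section Lifting.
Variables (R : realType) (H : hilbertType R) (T A : {linear H -> H}).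
Hypothesis AB : bounded_operator A.
Hypothesis AP : pos_form (fun x y => inner (A x) y).
Hypothesis TA : forall x, rnorm (T x) ^+ 2 <= complex.Re (inner (A x) x).
Hypothesis TAT : forall x,
  complex.Re (inner (A (T x)) (T x)) <= complex.Re (inner (A x) x).

Local Notation M := (opnorm A).
Let iP := inner_form H.

Lemma form_opnorm x : complex.Re (inner (A x) x) <= M * rnorm x ^+ 2.
Proof.
apply: (le_trans (Re_inner_le _ _)); rewrite expr2 mulrA.
by rewrite ler_wpM2r ?rnorm_ge0// rnorm_opnorm.
Qed.

(** The increment of the weights: the form of [2 (A - T^* A T)]. *)
Definition growth x y : R[i] :=
  (2 : R)%:C * (inner (A x) y - inner (A (T x)) (T y)).

(** The weight of index 1 is the form of [2 A + I - T^* T], which makes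
    [|S (h, 0, ...)|^2 = |T h|^2 + w_1 (h, h)] equal to [<(I + 2 A) h, h>]. *)
Definition lift_weight n x y : R[i] :=
  if n is k.+1 then (2 : R)%:C * inner (A x) y + inner x y - inner (T x) (T y)
                    + (k%:R : R)%:C * growth x y
  else inner x y.

Lemma growth_form : pos_form growth.
Proof.
split=> [a x y z|x y|x]; rewrite /growth.
- by rewrite !linearP !(pform_lin iP); ring.
- rewrite rmorphM rmorphB /= conj_real.
  by rewrite (pform_conj AP x y) (pform_conj AP (T x) (T y)).
- by rewrite cReZ cReB mulr_ge0// subr_ge0.
Qed.

Lemma growth_le x : complex.Re (growth x x) <= 2 * M * rnorm x ^+ 2.
Proof.
rewrite /growth cReZ cReB -mulrA ler_pM2l//.
by have := form_opnorm x; have := pform_ge0 AP (T x); lra.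
Qed.

Lemma Re_lift_weightS k x : complex.Re (lift_weight k.+1 x x) =
  2 * complex.Re (inner (A x) x) + rnorm x ^+ 2 - rnorm (T x) ^+ 2
  + k%:R * complex.Re (growth x x).
Proof. by rewrite cReD cReB cReD 2!cReZ -!rnorm_sqr. Qed.

Lemma lift_weight_form n : pos_form (lift_weight n).
Proof.
case: n => [|k]; first exact: iP.
split=> [a x y z|x y|x]; rewrite ?Re_lift_weightS /lift_weight.
- by rewrite (pform_lin growth_form) !linearP !(pform_lin iP); ring.
- rewrite (pform_conj growth_form x y) (pform_conj AP x y).
  rewrite (pform_conj iP x y) (pform_conj iP (T x) (T y)).
  by rewrite !(rmorphD, rmorphM, rmorphN) /= !conj_real.
- have := TA x; have := sqr_ge0 (rnorm x); have := sqr_ge0 (rnorm (T x)).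
  have : 0 <= k%:R * complex.Re (growth x x).
    by rewrite mulr_ge0// (pform_ge0 growth_form).
  move: (k%:R * _) => g; lra.
Qed.

(** Since [T^* T <= A], the part [2 A - T^* T] of the weight added to the
    identity is at least [A], hence nonnegative. *)
Lemma lift_weight_ge n x : rnorm x ^+ 2 <= complex.Re (lift_weight n x x).
Proof.
case: n => [|k]; first by rewrite rnorm_sqr.
rewrite Re_lift_weightS.
have := TA x; have := sqr_ge0 (rnorm (T x)).
have : 0 <= k%:R * complex.Re (growth x x).
  by rewrite mulr_ge0// (pform_ge0 growth_form).
move: (k%:R * _) => g; lra.
Qed.

Lemma lift_weight_le n : exists C : R, forall x,
  complex.Re (lift_weight n x x) <= C * rnorm x ^+ 2.
Proof.
case: n => [|k]; first by exists 1 => x; rewrite mul1r rnorm_sqr.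
exists (2 * M + 1 + k%:R * (2 * M)) => x.
rewrite Re_lift_weightS.
have := form_opnorm x; have := sqr_ge0 (rnorm (T x)).
have : k%:R * complex.Re (growth x x) <= k%:R * (2 * M * rnorm x ^+ 2).
  by rewrite ler_wpM2l// growth_le.
move: (k%:R) => j; lra.
Qed.

Definition lift_weights : weights H :=
  Weights lift_weight_form lift_weight_ge lift_weight_le.

Definition lift_space : hilbertType R := wl2 lift_weights.
Local Notation K := lift_space.

Lemma inner_winner (u v : K) : inner u v = @winner _ _ lift_weights u v.
Proof. by []. Qed.

Definition shift_seq (u : nat -> H) n := if n is k.+1 then u k else T (u 0%N).

(** Partial sums of the form of [S^* S - I]. *)
Definition defect (u v : nat -> H) N : R[i] :=
  (2 : R)%:C * inner (A (u 0%N)) (v 0%N) + \sum_(n < N) growth (u n.+1) (v n.+1).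

(** At the coordinate 0, [<T x, T y> + w_1 (x, y) = <x, y> + 2 <A x, y>]; at a
    later one, the shift moves the weight one step along its arithmetic
    progression. *)
Lemma psum_shift u v N :
  psum lift_weights (shift_seq u) (shift_seq v) N.+2 =
  psum lift_weights u v N.+1 + defect u v N.
Proof.
rewrite /defect; elim: N => [|N IH].
  by rewrite !psumS !psum0 big_ord0 /=; ring.
rewrite psumS IH [in RHS]psumS [in RHS]big_ord_recr /= -natr1 rmorphD /=.
by ring.
Qed.

(** The identity [S^* D S = D] for the defect [D]: the new coordinate 0
    contributes [2 <A T x, T y>] and the new coordinate 1 contributes
    [growth x y], with sum [2 <A x, y>]. *)
Lemma defect_shift u v N :
  defect (shift_seq u) (shift_seq v) N.+1 = defect u v N.
Proof.
by rewrite /defect big_ord_recl /= /growth addrA; congr (_ + _); ring.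
Qed.

Lemma defect_ge0 u N : 0 <= complex.Re (defect u u N).
Proof.
rewrite /defect cReD cReZ addr_ge0// ?mulr_ge0//; first exact: pform_ge0 AP _.
elim/big_ind: _ => //= [x y ? ?|n _]; first by rewrite cReD addr_ge0.
exact: pform_ge0 growth_form _.
Qed.

(** Each weight dominates the inner product of [H], so both [2 A] and
    [growth <= 2 A] are at most [2 |A|] times the weight of their coordinate. *)
Lemma defect_le u N :
  complex.Re (defect u u N) <= 2 * M * wsq lift_weights u N.+1.
Proof.
have M0 := opnorm_ge0 AB.
rewrite /defect; elim: N => [|N IH].
  rewrite /wsq psumS psum0 big_ord0 /= addr0 add0r cReZ -rnorm_sqr -mulrA.
  by rewrite ler_pM2l// form_opnorm.
rewrite big_ord_recr /= addrA cReD wsqS mulrDr lerD//.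
apply: (le_trans (growth_le _)); rewrite ler_wpM2l ?mulr_ge0//.
exact: lift_weight_ge.
Qed.

Lemma shift_pred (u : K) : shift_seq u \in wl2_pred lift_weights.
Proof.
have /wl2P[C uC] := wl2_valP u; apply/wl2P.
exists ((1 + 2 * M) * C) => N.
apply: (le_trans (wsq_nd lift_weights (shift_seq u)
  (leq_trans (leqnSn N) (leqnSn _)))).
rewrite /wsq psum_shift cReD -/(wsq _ _ _).
have := defect_le u N; have := uC N.+1; have := opnorm_ge0 AB.
move: (wsq _ _ _) => W; nra.
Qed.

Definition shift (u : K) : K := Wl2 (shift_pred u).

Lemma shift_linear : linear shift.
Proof.
move=> a u v; apply: wl2_eqP => -[|n] //=.
exact: linearP.
Qed.

Lemma defect_cvg (u v : K) :
  ccvg (defect u v) (inner (shift u) (shift v) - inner u v).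
Proof.
have H1 := (ccvg_shift _ _).2 ((ccvg_shift _ _).2 (winnerP (shift u) (shift v))).
have H2 := (ccvg_shift _ _).2 (winnerP u v).
have := ccvg_lin (-1) H2 H1; rewrite !mulN1r addrC.
congr (ccvg _ _); apply/funext => N.
by rewrite psum_shift mulN1r addrA addNr add0r.
Qed.

Lemma shift_defect (u v : K) :
  inner (shift (shift u)) (shift (shift v)) - inner (shift u) (shift v)
  = inner (shift u) (shift v) - inner u v.
Proof.
apply/esym; apply: ccvg_unique (defect_cvg u v) _.
have := (ccvg_shift _ _).2 (defect_cvg (shift u) (shift v)).
by congr (ccvg _ _); apply/funext => N; rewrite -[RHS]defect_shift.
Qed.

Lemma shift_ge (u : K) :
  complex.Re (inner u u) <= complex.Re (inner (shift u) (shift u)).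
Proof.
apply: winner_le => N; apply: le_trans (winner_ge N.+2 (shift u)).
rewrite /wsq psum_shift cReD -[leLHS]addr0 lerD ?defect_ge0//.
exact: wsq_nd.
Qed.

Lemma shift_le (u : K) : complex.Re (inner (shift u) (shift u)) <=
  (1 + 2 * M) * complex.Re (inner u u).
Proof.
apply: winner_le => N.
apply: (le_trans (wsq_nd lift_weights (shift u)
  (leq_trans (leqnSn N) (leqnSn _)))).
rewrite /wsq psum_shift cReD -/(wsq _ _ _).
have := defect_le u N; have := winner_ge N.+1 u; have := opnorm_ge0 AB.
rewrite inner_winner; move: (wsq _ _ _) => W; nra.
Qed.

Definition embed_seq (h : H) n : H := if n is 0%N then h else 0.

Lemma psum_embed h v N :
  psum lift_weights (embed_seq h) v N.+1 = inner h (v 0%N).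
Proof.
rewrite /psum big_ord_recl big1 ?addr0// => n _.
exact: pform0l (lift_weight_form _) _.
Qed.

Lemma embed_pred h : embed_seq h \in wl2_pred lift_weights.
Proof.
apply/wl2P; exists (complex.Re (inner h h)) => N.
by apply: (le_trans (wsq_nd _ _ (leqnSn N))); rewrite /wsq psum_embed.
Qed.

Definition embed h : K := Wl2 (embed_pred h).

Lemma embed_linear : linear embed.
Proof.
move=> a u v; apply: wl2_eqP => -[|n] //=.
by rewrite [RHS](_ : _ = a *: (0 : H) + 0)// scaler0 addr0.
Qed.

Lemma inner_embed h (v : K) : inner (embed h) v = inner h (wl2_val v 0%N).
Proof.
apply: ccvg_unique (winnerP _ _) _; apply/ccvg_shift.
have := ccvg_cst (inner h (wl2_val v 0%N)).
by congr (ccvg _ _); apply/funext => N; rewrite psum_embed.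
Qed.

Lemma inner_embedr h (v : K) : inner v (embed h) = inner (wl2_val v 0%N) h.
Proof.
by rewrite (pform_conj (inner_form _)) inner_embed -(pform_conj (inner_form _)).
Qed.

Lemma defect_embed (u : K) h N :
  defect u (embed h) N = (2 : R)%:C * inner (A (wl2_val u 0%N)) h.
Proof.
rewrite /defect big1 ?addr0// => n _.
exact: pform0r growth_form _.
Qed.

(** The defect maps [embed h] to [embed (2 A h)], hence preserves the copy of
    [H]. *)
Lemma shift_embed (u : K) h :
  inner (shift u) (shift (embed h)) = inner u (embed (h + (2 : R)%:C *: A h)).
Proof.
have -> : inner (shift u) (shift (embed h)) = inner u (embed h) +
    (2 : R)%:C * inner (A (wl2_val u 0%N)) h.
  apply/eqP; rewrite addrC -subr_eq; apply/eqP.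
  apply: ccvg_unique (defect_cvg _ _) _.
  have := ccvg_cst ((2 : R)%:C * inner (A (wl2_val u 0%N)) h).
  by congr (ccvg _ _); apply/funext => N; rewrite defect_embed.
rewrite !inner_embedr (pformDr iP) (pformZr iP) conj_real.
by rewrite (pform_conj AP) -(pform_conj iP).
Qed.

(** The defect has norm at least [2 |A|] because it acts as [2 A] on the copy
    of [H]. *)
Lemma lifting_exists : exists (K : hilbertType R) (J : {linear H -> K})
    (S : {linear K -> K}), two_isometric_lifting_typeII J T S /\
  opnorm (adj S \o S - id) = 2 * M.
Proof.
have [J JE] := linear_exists embed_linear.
have [S SE] := linear_exists shift_linear.
exists K, J, S.
have M0 := opnorm_ge0 AB.
have kP := inner_form K.
have JS : isometric_embedding J.
  by move=> x y; rewrite !JE inner_embed.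
have Sb : bounded_operator S.
  exists (Num.sqrt (1 + 2 * M)) => u.
  rewrite SE !rnorm_sqrt -sqrtrM; last by rewrite addr_ge0// mulr_ge0.
  by rewrite ler_wsqrtr// shift_le.
have [S' _ S'E] := adjoint_exists Sb.
have adjS y : adj S y = S' y by apply: adjE => x; apply: S'E.
have projJ k : proj J k = wl2_val k 0%N.
  apply: projE => // g; rewrite !JE inner_embedr.
  by rewrite (_ : wl2_val _ _ = wl2_val k 0%N - wl2_val k 0%N)// subrr (pform0l iP).
have SSJ h : adj S (S (J h)) = J (h + (2 : R)%:C *: A h).
  by apply: adjE => x; rewrite !SE !JE shift_embed.
split; [split|].
- by split => //; apply/funext => u /=; rewrite !projJ SE.
- apply/funext => u; apply: inner_inj => x.
  rewrite !fctE /= !adjS; set z := (X in inner x X).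
  (* Regroup into the difference of the defects at S u and at u. *)
  have -> : z = S' (S' (S (S u))) - S' (S u) - (S' (S u) - u).
    rewrite /z scaler_nat mulr2n opprD !addrA opprB -!addrA.
    by congr (_ + (_ + _)); rewrite addrC.
  rewrite !(pformBr kP) -!S'E !SE shift_defect subrr.
  exact/esym/(pform0r kP).
- by move=> _ [_ [h _ <-] <-]; exists (h + (2 : R)%:C *: A h) => //=; rewrite SSJ.
pose D (u : K) : K := adj S (S u) - u.
have -> : adj S \o S - id = D by [].
pose d (u v : K) := inner (shift u) (shift v) - inner u v.
have dE u v : inner u (D v) = d u v.
  by rewrite /D (pformBr kP) adjS -S'E !SE.
have dP : pos_form d.
  split=> [a x y z|x y|x]; rewrite /d.
  - by rewrite shift_linear !(pform_lin kP); ring.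
  - by rewrite rmorphB /= -!(pform_conj kP).
  - by rewrite cReB subr_ge0 shift_ge.
have dle u : complex.Re (d u u) <= 2 * M * rnorm u ^+ 2.
  by rewrite /d cReB rnorm_sqr; have := shift_le u; lra.
(* Cauchy-Schwarz for the nonnegative form d gives
   |D u|^4 = d (D u) u ^2 <= d (D u) (D u) * d u u. *)
have Dle u : rnorm (D u) <= 2 * M * rnorm u.
  have [->|Du0] := eqVneq (rnorm (D u)) 0.
    by rewrite !mulr_ge0 ?rnorm_ge0.
  have Du : 0 < rnorm (D u) ^+ 2.
    by rewrite exprn_gt0// lt_neqAle eq_sym Du0 rnorm_ge0.
  rewrite -(@ler_pXn2r _ 2) ?nnegrE ?mulr_ge0 ?rnorm_ge0//.
  rewrite -(ler_pM2l Du).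
  have := ler_pM (pform_ge0 dP _) (pform_ge0 dP _) (dle (D u)) (dle u).
  have := pform_CauchySchwarz dP (D u) u; rewrite -[d (D u) u]dE -rnorm_sqr.
  move=> /le_trans/[apply].
  by congr (_ <= _); ring.
apply/eqP; rewrite eq_le opnorm_le ?mulr_ge0//=.
suff : M <= opnorm D / 2 by lra.
apply: opnorm_le_ball => x x1.
suff : 2 * rnorm (A x) <= opnorm D by lra.
have Jx : rnorm (J x) = rnorm x by rewrite !rnorm_sqrt JS.
have := opnorm_ge Dle (x := J x); rewrite Jx => /(_ x1).
rewrite /D SSJ linearD /= [J x + _]addrC addrK.
rewrite linearZ/= rnormZ// (_ : rnorm (J (A x)) = rnorm (A x))//.
by rewrite !rnorm_sqrt JS.
Qed.

End Lifting.

(** * Operators dominating T *)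

Lemma inner_adjr (R : realType) (H K : hilbertType R) (T : {linear H -> K}) x y :
  bounded_operator T -> inner (T x) y = inner x (adj T y).
Proof.
move=> /adjoint_exists[T' _ T'E].
by rewrite (_ : adj T y = T' y)//; apply: adjE => z; apply: T'E.
Qed.

Lemma inner_adjl (R : realType) (H K : hilbertType R) (T : {linear H -> K}) x y :
  bounded_operator T -> inner (adj T y) x = inner y (T x).
Proof.
move=> TB; rewrite (pform_conj (inner_form H)) -inner_adjr//.
by rewrite -(pform_conj (inner_form K)).
Qed.

Section Domination.
Variables (R : realType) (H : hilbertType R).

Lemma bounded_scale_comp (f g h : {linear H -> H}) (c : R) : 0 <= c ->
  bounded_operator f -> bounded_operator g ->
  (forall x, h x = c%:C *: f (g x)) -> bounded_operator h.
Proof.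
move=> c0 /bounded_ge0[m m0 fm] [n gn] hE; exists (c * (m * n)) => x.
rewrite hE rnormZ// -mulrA ler_wpM2l// (le_trans (fm _))// -mulrA.
by rewrite ler_wpM2l.
Qed.

Lemma le_operator_form (A B : H -> H) (p q : H -> H -> R[i]) :
  pos_form p -> pos_form q ->
  (forall x, inner (A x) x = p x x) -> (forall x, inner (B x) x = q x x) ->
  (forall x, complex.Re (p x x) <= complex.Re (q x x)) -> le_operator A B.
Proof.
move=> pP qP Ap Bq pq x.
rewrite (pformBl (inner_form H)) Ap Bq (pform_real pP) (pform_real qP).
by rewrite subr_ge0 lecR.
Qed.

(** With [T = N C L], the form [c <L x, L y>] is contracted by [T] because
    [L T = C L]; the constant [c] exceeds the square of a bound of [N], which
    gives [|T x|^2 <= c |C L x|^2 <= c |L x|^2], and is kept positive so that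
    [c^-1 N N^*] is an inverse. *)
Lemma dominating_operator_exists (T : {linear H -> H}) :
  similar_to_contraction T ->
  exists A : {linear H -> H},
    [/\ bounded_operator A, invertible_operator A,
        pos_form (fun x y => inner (A x) y),
        forall x, rnorm (T x) ^+ 2 <= complex.Re (inner (A x) x) &
        forall x, complex.Re (inner (A (T x)) (T x)) <=
                  complex.Re (inner (A x) x)].
Proof.
move=> [L [N [C [[LB NB LN NL] CB C1 TE]]]]; have iP := inner_form H.
have {}TE x : T x = N (C (L x)) by rewrite TE.
have {}LN x : L (N x) = x by rewrite -[LHS]/((L \o N) x) LN.
have {}NL x : N (L x) = x by rewrite -[LHS]/((N \o L) x) NL.
have Cle x : rnorm (C x) <= rnorm x.
  apply: (le_trans (rnorm_opnorm x CB)).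
  by rewrite -[leRHS]mul1r ler_wpM2r ?rnorm_ge0.
have [m m0 Nm] := bounded_ge0 NB.
pose c := m ^+ 2 + 1.
have c0 : 0 < c by rewrite ltr_pwDr ?sqr_ge0.
have cV : c%:C * c^-1%:C = 1 :> R[i] by rewrite -rmorphM /= divff ?gt_eqF.
have [L' L'B L'E] := adjoint_exists LB.
have [N' N'B N'E] := adjoint_exists NB.
have L'N' x : L' (N' x) = x.
  by apply: inner_inj => y; rewrite -L'E -N'E NL.
have N'L' x : N' (L' x) = x.
  by apply: inner_inj => y; rewrite -N'E -L'E LN.
have [A AE] : exists A : {linear H -> H}, forall x, A x = c%:C *: L' (L x).
  apply: linear_exists => a x y.
  by rewrite !linearP !scalerA mulrC.
have [B BE] : exists B : {linear H -> H}, forall x, B x = c^-1%:C *: N (N' x).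
  apply: linear_exists => a x y.
  by rewrite !linearP !scalerA mulrC.
have AB : bounded_operator A by apply: bounded_scale_comp AE => //; apply: ltW.
have BB : bounded_operator B.
  by apply: bounded_scale_comp BE => //; rewrite invr_ge0 ltW.
have Aform x y : inner (A x) y = c%:C * inner (L x) (L y).
  rewrite AE (pformZl iP); congr (_ * _).
  by rewrite (pform_conj iP) -L'E -(pform_conj iP).
exists A; split=> //.
- exists B; split=> //; apply/funext => x /=.
    by rewrite AE BE !linearZ /= LN L'N' scalerA ?[_ * c%:C]mulrC cV scale1r.
  by rewrite AE BE !linearZ /= N'L' NL scalerA ?[_ * c%:C]mulrC cV scale1r.
- split=> [a x y z|x y|x].
  + by rewrite linearP (pform_lin iP).
  + by rewrite !Aform rmorphM /= conj_real -(pform_conj iP).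
  + by rewrite Aform cReZ mulr_ge0 ?(ltW c0)// (pform_ge0 iP).
- move=> x; rewrite Aform cReZ -rnorm_sqr TE.
  have : rnorm (N (C (L x))) <= m * rnorm (L x).
    by apply: (le_trans (Nm _)); rewrite ler_wpM2l.
  rewrite -(@ler_pXn2r _ 2) ?nnegrE ?mulr_ge0 ?rnorm_ge0// exprMn.
  have := sqr_ge0 (rnorm (L x)); rewrite /c; lra.
- move=> x; rewrite !Aform !cReZ -!rnorm_sqr ler_pM2l// TE LN.
  by rewrite ler_pXn2r ?nnegrE ?rnorm_ge0.
Qed.

End Domination.

Theorem corollary4p4 (R : realType) (H : hilbertType R) (T : {linear H -> H})
    (T_bounded : bounded_operator T)
    (T_noncontractive : ~ contraction_operator T)
    (T_similar : similar_to_contraction T) :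
  exists A0 : {linear H -> H},
    [/\ bounded_operator A0, positive_operator A0 & invertible_operator A0] /\
    [/\ le_operator (adj T \o A0 \o T) A0,
        le_operator (adj T \o T) A0,
        exists (K : hilbertType R) (J : {linear H -> K}) (S : {linear K -> K}),
          two_isometric_lifting_typeII J T S /\
          covariance S = Num.sqrt 2%:R * Num.sqrt (opnorm A0)
      & opnorm T <= opnorm A0].
Proof.
have iP := inner_form H.
have [A [AB Ainv AP TA TAT]] := dominating_operator_exists T_similar.
have pull (p : H -> H -> R[i]) :
    pos_form p -> pos_form (fun x y => p (T x) (T y)).
  move=> pP; split=> [a x y z|x y|x]; first by rewrite linearP (pform_lin pP).
    exact: pform_conj pP _ _.
  exact: pform_ge0 pP _.
exists A; split.
  by split=> // x; rewrite (pform_real AP) ler0c (pform_ge0 AP).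
split.
- apply: (le_operator_form (pull _ AP) AP) => // x.
  by rewrite /= inner_adjl.
- apply: (le_operator_form (pull _ iP) AP) => // x.
    by rewrite /= inner_adjl.
  by rewrite -rnorm_sqr.
- have [K [J [S [JS SA]]]] := lifting_exists AB AP TA TAT.
  exists K, J, S; split=> //.
  by rewrite /covariance SA sqrtrM.
have T1 : 1 < opnorm T by rewrite ltNge; apply/negP.
(* From |T x|^2 <= <A x, x> one gets |T| <= sqrt |A|, and |T| > 1 then makes
   sqrt |A| at most |A|. *)
have TsA : opnorm T <= Num.sqrt (opnorm A).
  apply: opnorm_le_ball => x x1.
  rewrite -(@ger0_norm _ (rnorm (T x))) ?rnorm_ge0// -sqrtr_sqr ler_wsqrtr//.
  apply: (le_trans (TA x)); apply: (le_trans (form_opnorm AB x)).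
  rewrite -[leRHS]mulr1 ler_wpM2l ?opnorm_ge0//.
  by rewrite exprn_ile1 ?rnorm_ge0.
have sA1 : 1 <= Num.sqrt (opnorm A) by apply: ltW (lt_le_trans T1 TsA).
apply: (le_trans TsA).
rewrite -[leRHS]sqr_sqrtr ?opnorm_ge0// expr2.
by rewrite -[leLHS]mulr1 ler_wpM2l ?sqrtr_ge0.
Qed.
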